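(* Let $Q$ be an IP-polygon of maximal local index $m_Q = k \geq 2$. Then \[|\partial Q \cap N|\leq 4k^2+8k,\qquad \mathrm{Vol}(Q)\leq 4k^3+8k^2.\]
   Context: Fix a lattice $N\cong\mathbb{Z}^2$ with dual lattice $M=\mathrm{Hom}(N,\mathbb{Z})$ and pairing $\langle\cdot,\cdot\rangle$. Lattice polygons live in $N_{\mathbb{Q}}=N\otimes_{\mathbb{Z}}\mathbb{Q}$ (one may equivalently work in $N\otimes\mathbb{R}$). A lattice polygon $Q$ is the convex hull of finitely many points of $N$, with non-empty interior. $Q$ is an IP-polygon if the origin $\mathbf{0}$ lies in the (strict) interior of $Q$. The facets of $Q$ are its edges. For a facet $F$, $\eta_F\in M$ is the unique primitive lattice point defining an outer normal of $F$, and the local index $l_F:=\langle\eta_F,F\rangle$ is the constant value of $\eta_F$ on $F$ (the integral distance between $\mathbf{0}$ and $F$; a positive integer). The maximal local index is $m_Q:=\max\{l_F : F \text{ a facet of } Q\}$. $\partial Q$ is the boundary of $Q$, $|\cdot|$ is cardinality, and $\mathrm{Vol}(Q)$ is the normalised volume, i.e. twice the Euclidean area (with $N$ identified with $\mathbb{Z}^2$). *)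

(* Defs.v *)
From mathcomp Require Import all_boot all_order all_algebra.
From mathcomp Require Import all_classical all_reals all_analysis.

Import Order.TTheory GRing.Theory Num.Theory.
Import numFieldNormedType.Exports.

Set Implicit Arguments.
Unset Strict Implicit.
Unset Printing Implicit Defensive.

Local Open Scope classical_set_scope.
Local Open Scope ring_scope.

(* The lattice N and its dual M are both identified with Z^2, i.e. int * int,
   the pairing being the standard bilinear form; the ambient real plane is
   R * R. *)
Definition lattice_pt (R : realType) (p : int * int) : R * R :=
  (p.1%:~R, p.2%:~R).

Definition pairing (R : realType) (u x : R * R) : R :=
  u.1 * x.1 + u.2 * x.2.

Definition convex_hull (R : realType) (A : set (R * R)) : set (R * R) :=
  smallest (fun B : set (R^o * R^o) => convex_set B) A.

Definition lattice_polygon (R : realType) (Q : set (R * R)) : Prop :=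
  (exists V : set (int * int),
     finite_set V /\ Q = convex_hull (lattice_pt R @` V)) /\
  Q° !=set0.

Definition IP_polygon (R : realType) (Q : set (R * R)) : Prop :=
  lattice_polygon Q /\ Q° (0, 0).

Definition boundary (R : realType) (Q : set (R * R)) : set (R * R) :=
  closure Q `\` Q°.

Definition face (R : realType) (Q : set (R * R)) (u : R * R) : set (R * R) :=
  [set x | Q x /\ forall y, Q y -> pairing u y <= pairing u x].

(* An edge of a polygon is a one-dimensional face; as proper faces have
   dimension at most 1, it suffices to ask for two distinct points. *)
Definition facet (R : realType) (Q F : set (R * R)) : Prop :=
  (exists2 u : R * R, u != (0, 0) & F = face Q u) /\
  exists x y, [/\ F x, F y & x != y].

Definition primitive_outer_normal (R : realType) (Q F : set (R * R))
    (eta : int * int) : Prop :=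
  coprimez eta.1 eta.2 /\ F = face Q (lattice_pt R eta).

(* Local indices are relations; for a lattice polygon (which has non-empty
   interior) every facet has exactly one primitive outer normal, hence exactly
   one local index. *)
Definition local_index (R : realType) (Q F : set (R * R)) (l : int) : Prop :=
  exists2 eta : int * int, primitive_outer_normal Q F eta &
    forall x, F x -> pairing (lattice_pt R eta) x = l%:~R.

Definition maximal_local_index (R : realType) (Q : set (R * R)) (m : int)
    : Prop :=
  let L := [set l | exists2 F, facet Q F & local_index Q F l] in
  L m /\ ubound L m.

Definition boundary_lattice_pts (R : realType) (Q : set (R * R))
    : set (int * int) :=
  lattice_pt R @^-1` boundary Q.

Definition normalized_volume (R : realType) (Q : set (R * R)) : \bar R :=
  (2%:E * (@lebesgue_measure R \x @lebesgue_measure R) Q)%E.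

(* Main.v *)
(* If a primitive normal u takes the values l > 0 on an edge of Q and -h < 0 as
   its minimum, then Q is cut into lattice rows by the lines u = Y.  The row
   through the origin leaves Q on both sides through (the lines supporting) edges
   whose normals are not constant on it, hence at lattice distance at most k from
   the origin, so it has lattice length at most 2k.  The same two supporting lines
   bound the length of every row by an affine function W of Y, with
   h W(l) + l W(-h) = (l + h) W(0) <= 2k (l + h).  Integrating W bounds the
   volume; an inner row carries at most two boundary points and the rows Y = l
   and Y = -h at most W(l) + 1 and W(-h) + 1, which bounds their number.
   All this is useful if l and h are controlled: l <= k, and an inscribed triangle
   of maximal area provides an edge with h <= 2l. *)
Require Import Defs.
From mathcomp Require Import all_boot all_order all_algebra.
From mathcomp Require Import all_classical all_reals all_analysis.
From mathcomp Require Import measurable_realfun zify ring lra.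

Set Implicit Arguments.
Unset Strict Implicit.
Unset Printing Implicit Defensive.

Import Order.TTheory GRing.Theory Num.Theory.
Import numFieldNormedType.Exports.

Local Open Scope classical_set_scope.
Local Open Scope card_scope.
Local Open Scope ring_scope.

(** * Edges of a lattice polygon *)

Definition zdot (u v : int * int) : int := u.1 * v.1 + u.2 * v.2.

(** Integral encoding of an edge: [n] is its primitive outer normal, [v] and [w] are two distinct
    points of [V] on it, not necessarily its ends, and [zdot n v] is its local index. *)
Definition is_edge (V : seq (int * int)) (n v w : int * int) : Prop :=
  [/\ v \in V, w \in V, v != w, coprimez n.1 n.2 &
      zdot n v = zdot n w /\ {in V, forall z, zdot n z <= zdot n v}].

(** Dual form of the origin being interior to the hull: [V] lies in no closed half-plane through the
    origin with integral normal. *)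
Definition surrounds_origin (V : seq (int * int)) : Prop :=
  forall e, e != 0 -> exists2 v, v \in V & 0 < zdot e v.

Lemma seq_argmax (T : eqType) (d : Order.disp_t) (D : orderType d)
    (f : T -> D) (s : seq T) (x : T) :
  x \in s -> exists2 y, y \in s & {in s, forall z, (f z <= f y)%O}.
Proof.
elim: s x => // a s IH x _.
case: s IH => [_|b s IH].
  by exists a; rewrite ?mem_head// => z; rewrite inE => /eqP ->.
have [y ys ymax] := IH b (mem_head _ _).
have [ay|ya] := leP (f a) (f y).
  exists y; first by rewrite inE ys orbT.
  by move=> z; rewrite inE => /orP[/eqP ->//|]; exact: ymax.
exists a; first exact: mem_head.
by move=> z; rewrite inE => /orP[/eqP ->//|/ymax /le_trans]; apply; exact: ltW.
Qed.

Lemma zdotDr u v w : zdot u (v + w) = zdot u v + zdot u w.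
Proof. by rewrite /zdot /=; ring. Qed.

Lemma zdotNr u v : zdot u (- v) = - zdot u v.
Proof. by rewrite /zdot /=; ring. Qed.

Lemma zdotNl u v : zdot (- u) v = - zdot u v.
Proof. by rewrite /zdot /=; ring. Qed.

Lemma zdotBr u v w : zdot u (v - w) = zdot u v - zdot u w.
Proof. by rewrite zdotDr zdotNr. Qed.

Lemma zdot_self_gt0 d : d != 0 -> 0 < zdot d d.
Proof.
case: d => a b; rewrite /zdot /= -!expr2 lt_neqAle addr_ge0 ?sqr_ge0// andbT.
apply: contra => /eqP/esym/eqP; rewrite paddr_eq0 ?sqr_ge0// !sqrf_eq0.
by move=> /andP[/eqP -> /eqP ->].
Qed.

Lemma primitive_multiple (n : int * int) : n != 0 ->
  exists (g : int) (m : int * int),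
    [/\ 0 < g, n = (g * m.1, g * m.2) & coprimez m.1 m.2].
Proof.
case: n => a b n0.
have g0 : 0 < gcdz a b.
  rewrite lt_neqAle eq_sym le0z_nat andbT gcdz_eq0.
  by apply: contra n0 => /andP[/eqP -> /eqP ->].
have ga : (gcdz a b %| a)%Z by exact: dvdz_gcdl.
have gb : (gcdz a b %| b)%Z by exact: dvdz_gcdr.
exists (gcdz a b), (divz a (gcdz a b), divz b (gcdz a b)); split => //=.
  by rewrite ![gcdz a b * _]mulrC !divzK.
rewrite /coprimez; apply/eqP; apply: (mulfI (lt0r_neq0 g0)).
have := @mulz_gcdr (gcdz a b) (divz a (gcdz a b)) (divz b (gcdz a b)).
rewrite ![gcdz a b * divz _ _]mulrC !divzK// mulr1.
by rewrite gez0_abs // ltW.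
Qed.

(** At a vertex maximising [d], tilting [d] towards a perpendicular [e] turns it into the normal of
    an edge. The added multiple of [e] does not affect the pairing with [d], which stays
    positive. *)
Lemma edge_normal (V : seq (int * int)) (d : int * int) :
  surrounds_origin V -> d != 0 ->
  exists n v w, is_edge V n v w /\ 0 < zdot n d.
Proof.
move=> hV d0.
have [v0 v0V _] := hV d d0.
have [v vV vmax] := seq_argmax (zdot d) v0V.
have [e [ed [w0 w0V w0v]]] : exists e, zdot e d = 0 /\
    exists2 w, w \in V & zdot e v < zdot e w.
  pose p : int * int := (- d.2, d.1).
  have p0 : p != 0.
    apply: contra d0; rewrite -!pair_eqE /= /p /pair_eq /= oppr_eq0.
    by rewrite andbC.
  have [|pv] := ltP (zdot p v) 0.
    have [z zV z0] := hV p p0 => v0'; exists p; split.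
      by rewrite /zdot /p /=; ring.
    by exists z => //; exact: lt_trans v0' z0.
  have Np0 : - p != 0 by rewrite oppr_eq0.
  have [z zV z0] := hV _ Np0.
  exists (- p); split; first by rewrite /zdot /p /=; ring.
  exists z => //; apply: le_lt_trans z0.
  by move: pv; rewrite /zdot /=; lia.
have d_le z : z \in V -> zdot d (z - v) <= 0.
  by move=> /vmax; rewrite zdotBr subr_le0.
(* rotate [d] towards [e] about the vertex [v] until a second vertex is hit *)
pose ratio w : rat := (zdot d (w - v))%:~R / (zdot e (w - v))%:~R.
have w0F : w0 \in [seq w <- V | zdot e v < zdot e w].
  by rewrite mem_filter w0v.
have [w] := seq_argmax ratio w0F.
rewrite mem_filter => /andP[ewv wV] wmax.
have ew_gt0 : 0 < zdot e (w - v) by rewrite zdotBr subr_gt0.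
have wmax' z : z \in V -> 0 < zdot e (z - v) ->
    zdot d (z - v) * zdot e (w - v) <= zdot d (w - v) * zdot e (z - v).
  move=> zV ez; have /wmax : z \in [seq w <- V | zdot e v < zdot e w].
    by rewrite mem_filter zV andbT -subr_gt0 -zdotBr.
  rewrite /ratio ler_pdivrMr ?ltr0z// mulrAC ler_pdivlMr ?ltr0z//.
  by rewrite -!intrM ler_int.
(* [N] is [d] minus [ratio w] times [e], cleared of denominators; it vanishes on [w - v], and
   maximality of the ratio makes [v] maximal for it. *)
pose N : int * int := (zdot e (w - v) * d.1 - zdot d (w - v) * e.1,
                       zdot e (w - v) * d.2 - zdot d (w - v) * e.2).
have NE z : zdot N z =
    zdot e (w - v) * zdot d z - zdot d (w - v) * zdot e z.
  by rewrite /N {1}/zdot /=; rewrite [zdot d z]/zdot [zdot e z]/zdot; ring.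
have Nd : 0 < zdot N d.
  by rewrite NE ed mulr0 subr0 mulr_gt0// zdot_self_gt0.
have N0 : N != 0 by apply: contraTneq Nd => ->; rewrite /zdot /= !mul0r.
have [g [n [g0 Ng np]]] := primitive_multiple N0.
have NgE z : zdot N z = g * zdot n z by rewrite Ng /zdot /=; ring.
exists n, v, w; split; last by move: Nd; rewrite NgE pmulr_rgt0.
split => //.
  by apply: contraTneq ewv => ->; rewrite ltxx.
split.
  apply: (mulfI (lt0r_neq0 g0)); rewrite -!NgE; apply/eqP.
  by rewrite -subr_eq0 -zdotBr -opprB zdotNr NE mulrC subrr oppr0.
move=> z zV; rewrite -(ler_pM2l g0) -!NgE -subr_le0 -zdotBr NE subr_le0.
have [ez|ez] := ltP 0 (zdot e (z - v)).
  by rewrite mulrC; exact: wmax'.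
apply: (@le_trans _ _ 0).
  by apply: mulr_ge0_le0; [exact: ltW|exact: d_le].
exact: mulr_le0 (d_le _ wV) ez.
Qed.

(* Twice the oriented area of a triangle. *)
Definition tri (a b c : int * int) : int :=
  (b.1 - a.1) * (c.2 - a.2) - (b.2 - a.2) * (c.1 - a.1).

(** Take [a] right and [b] left of the vertical axis. The line [ab] cannot contain [V], since [V]
    has points strictly on both sides of its parallel through the origin. *)
Lemma tri_gt0 (V : seq (int * int)) : surrounds_origin V ->
  exists a b c, [/\ a \in V, b \in V, c \in V & 0 < tri a b c].
Proof.
move=> hV.
have [a aV a0] := hV (1, 0) isT.
have [b bV b0] := hV (-1, 0) isT.
pose e : int * int := (- (b.2 - a.2), b.1 - a.1).
have e0 : e != 0.
  rewrite -pair_eqE /= /pair_eq /= negb_and; apply/orP; right.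
  by move: a0 b0; rewrite /zdot /=; lia.
have triE z : tri a b z = zdot e z - zdot e a.
  by rewrite /tri /zdot /e /=; ring.
have triN z : tri b a z = zdot e a - zdot e z.
  by rewrite /tri /zdot /e /=; ring.
have [|ea] := ltP (zdot e a) 0.
  have [z zV z0] := hV e e0 => ea.
  by exists a, b, z; split => //; rewrite triE subr_gt0 (lt_trans ea).
have Ne0 : - e != 0 by rewrite oppr_eq0.
have [z zV z0] := hV _ Ne0.
exists b, a, z; split => //; rewrite triN subr_gt0 (lt_le_trans _ ea)//.
by move: z0; rewrite /zdot /=; lia.
Qed.

(* If abc has maximal area among the triangles on V, then V lies in the image
   of abc under the homothety of ratio -2 at its centroid; the normal is chosen
   so that this centroid lies on its non-negative side. *)
Lemma balanced_edge (V : seq (int * int)) : surrounds_origin V ->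
  exists n v w, is_edge V n v w /\
    {in V, forall z, - (2 * zdot n v) <= zdot n z}.
Proof.
move=> hV.
have [a0 [b0 [c0 [a0V b0V c0V t0]]]] := tri_gt0 hV.
have [[[a b] c] /= /allpairsP[[[a' b'] c'] /= []]] := seq_argmax
  (fun x : (int * int) * (int * int) * (int * int) => tri x.1.1 x.1.2 x.2)
  (allpairs_f pair (allpairs_f pair a0V b0V) c0V).
move=> /allpairsP[[a'' b''] /= [aV bV [-> ->]]] cV [-> -> ->] {a b c a' b'}.
set a := a''; set b := b''; set c := c' => abcmax.
have tmax x y z : x \in V -> y \in V -> z \in V -> tri x y z <= tri a b c.
  move=> xV yV zV; apply: (abcmax (x, y, z)).
  exact: (allpairs_f pair (allpairs_f pair xV yV) zV).
have tpos : 0 < tri a b c by apply: lt_le_trans t0 _; exact: tmax.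
have [n [v [w [nvw nc]]]] : exists n v w, is_edge V n v w /\
    0 <= zdot n (a + b + c).
  have [s0|s0] := eqVneq (a + b + c) 0.
    have [n [v [w [nvw _]]]] := @edge_normal V (1, 0) hV isT.
    by exists n, v, w; split => //; rewrite s0 /zdot /= !mulr0.
  have [n [v [w [nvw nd]]]] := edge_normal hV s0.
  by exists n, v, w; split => //; exact: ltW.
exists n, v, w; split => // z zV.
have [vV wV vw np [_ nmax]] := nvw.
have ha := tmax _ _ _ zV bV cV.
have hb := tmax _ _ _ aV zV cV.
have hc := tmax _ _ _ aV bV zV.
have sumE : tri z b c + tri a z c + tri a b z = tri a b c.
  by rewrite /tri; ring.
have barE : tri a b c * zdot n z =
    tri z b c * zdot n a + tri a z c * zdot n b + tri a b z * zdot n c.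
  by rewrite /tri /zdot; ring.
rewrite -(ler_pM2l tpos) barE.
(* With [D = tri a b c], the differences between [D] and the scaled barycentric coordinates of [z]
   are non-negative by maximality and sum to [2 D]. As [n] is non-negative on [a + b + c], this
   costs at most [2 D (zdot n v)]. *)
have := ler_wpM2l (_ : 0 <= tri a b c - tri z b c) (nmax _ aV).
have := ler_wpM2l (_ : 0 <= tri a b c - tri a z c) (nmax _ bV).
have := ler_wpM2l (_ : 0 <= tri a b c - tri a b z) (nmax _ cV).
rewrite !subr_ge0 => /(_ hc) h1 /(_ hb) h2 /(_ ha) h3.
have h4 := mulr_ge0 (ltW tpos) nc.
rewrite !zdotDr in h4.
move: sumE h1 h2 h3 h4.
move: (tri a b c) (tri z b c) (tri a z c) (tri a b z) => D x y t.
move: (zdot n a) (zdot n b) (zdot n c) (zdot n v) => A B C M <-.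
by lia.
Qed.

(** * Convex hulls *)

Lemma nbhs_boxP (R : realType) (Q : set (R * R)) (x : R * R) :
  nbhs x Q <-> exists2 e : R, 0 < e &
    forall y, `|x.1 - y.1| < e -> `|x.2 - y.2| < e -> Q y.
Proof.
split=> [/nbhs_ballP[e /= e0 eQ]|[e e0 eQ]].
  by exists e => // y xy1 xy2; apply: eQ; split.
apply/nbhs_ballP; exists e => //= y [/= xy1 xy2]; exact: eQ.
Qed.

Lemma convex_hullE (R : realType) (A : set (R * R)) (x y : R * R) (t : R) :
  convex_hull A x -> convex_hull A y -> 0 <= t -> t <= 1 ->
  convex_hull A ((1 - t) * x.1 + t * y.1, (1 - t) * x.2 + t * y.2).
Proof.
move=> Ax Ay t0 t1 B [cB AB].
have t01 : t \in `[0, 1] by rewrite in_itv /= t0 t1.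
have := cB y x (Itv01 t0 t1); rewrite !inE => /(_ (Ay B (conj cB AB))).
move=> /(_ (Ax B (conj cB AB))).
set a := (X in B X -> _); set b := (X in _ -> B X).
suff -> : a = b by [].
rewrite /a /b; apply: injective_projections => /=; rewrite addrC; reflexivity.
Qed.

Lemma convex_hull_halfplane (R : realType) (A : set (R * R)) (u : R * R)
    (c : R) :
  (forall x, A x -> pairing u x <= c) ->
  forall x, convex_hull A x -> pairing u x <= c.
Proof.
move=> Ac x; apply: (@smallest_sub _ _ _ [set x | pairing u x <= c]) => //.
move=> {}x y t; rewrite !inE /= => xc yc.
have -> : pairing u (conv t x y) =
    t%:num * pairing u x + (1 - t%:num) * pairing u y.
  by rewrite /pairing /=; rewrite /GRing.scale /=; rewrite /unstable.onem; ring.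
have t0 : 0 <= t%:num by [].
have t1 : t%:num <= 1 by [].
by nra.
Qed.

(** Fix a hull point [y'] close to [y]. Any point near the combination is a combination of [y'] with
    a point that falls into the box around [x]. *)
Lemma convex_hull_interior (R : realType) (A : set (R * R)) (x y : R * R)
    (t : R) :
  (convex_hull A)° x -> closure (convex_hull A) y -> 0 <= t -> t < 1 ->
  (convex_hull A)° ((1 - t) * x.1 + t * y.1, (1 - t) * x.2 + t * y.2).
Proof.
set Q := convex_hull A.
move=> /nbhs_boxP[e e0 eQ] cy t0 t1.
apply/nbhs_boxP.
have t1' : 0 < 1 - t by rewrite subr_gt0.
(* Half of the shrunken radius [e * (1 - t)] pays for replacing [y] by [y'], half for moving the
   combination. *)
pose r := e * (1 - t) / 2.
have r0 : 0 < r by rewrite !mulr_gt0.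
have [y' [Qy' [yy1 yy2]]] : exists y', Q y' /\
    (`|y.1 - y'.1| < r /\ `|y.2 - y'.2| < r).
  have /cy[y' [Qy' yy']] : nbhs y [set z | `|y.1 - z.1| < r /\ `|y.2 - z.2| < r].
    by apply/nbhs_boxP; exists r.
  by exists y'.
have key (a b b' c : R) : `|b - b'| < r -> `|(1 - t) * a + t * b - c| < r ->
    `|a - (c - t * b') / (1 - t)| < e.
  move=> bb' cr.
  have -> : a - (c - t * b') / (1 - t) =
      (((1 - t) * a + t * b - c) - t * (b - b')) / (1 - t).
    by field; rewrite gt_eqF.
  rewrite normrM normfV (gtr0_norm t1') ltr_pdivrMr//.
  apply: (le_lt_trans (ler_normB _ _)).
  have -> : e * (1 - t) = r + r by rewrite /r; field.
  apply: ltr_leD => //; rewrite normrM (ger0_norm t0).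
  have := normr_ge0 (b - b'); nra.
exists r => // z /= z1 z2.
have := convex_hullE (eQ (((z.1 - t * y'.1) / (1 - t)),
  ((z.2 - t * y'.2) / (1 - t))) (key _ _ _ _ yy1 z1) (key _ _ _ _ yy2 z2))
  Qy' t0 (ltW t1).
congr (convex_hull A _); apply: injective_projections => /=;
  by field; rewrite gt_eqF.
Qed.

Lemma closure_halfplane (R : realType) (Q : set (R * R)) (u : R * R) (c : R) :
  (forall x, Q x -> pairing u x <= c) ->
  forall x, closure Q x -> pairing u x <= c.
Proof.
move=> Qc x cx; apply/ler_addgt0Pr => e e0.
pose M := `|u.1| + `|u.2| + 1.
have M0 : 0 < M by rewrite ltr_wpDl// addr_ge0.
have /cx[y [Qy [/= xy1 xy2]]] :
    nbhs x [set z | `|x.1 - z.1| < e / M /\ `|x.2 - z.2| < e / M].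
  by apply/nbhs_boxP; exists (e / M) => //; rewrite divr_gt0.
apply: le_trans (lerD (Qc _ Qy) (lexx e)).
have -> : pairing u x = pairing u y + (u.1 * (x.1 - y.1) + u.2 * (x.2 - y.2)).
  by rewrite /pairing; ring.
rewrite lerD2l; apply: le_trans (ler_norm _) _.
apply: le_trans (ler_normD _ _) _; rewrite !normrM.
have -> : e = M * (e / M) by field; rewrite gt_eqF.
have eM : 0 < e / M by rewrite divr_gt0.
rewrite /M !mulrDl mul1r -[leLHS]addr0; apply: lerD; last exact: ltW.
by apply: lerD; rewrite ler_wpM2l// ltW.
Qed.

Lemma pairing_lattice (R : realType) (u v : int * int) :
  pairing (lattice_pt R u) (lattice_pt R v) = (zdot u v)%:~R.
Proof. by rewrite /pairing /zdot /= intrD !intrM. Qed.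

Lemma lattice_hull_le (R : realType) (V : seq (int * int)) (n : int * int)
    (c : int) :
  {in V, forall v, zdot n v <= c} ->
  forall x, convex_hull (lattice_pt R @` [set` V]) x ->
    pairing (lattice_pt R n) x <= c%:~R.
Proof.
move=> nV; apply: convex_hull_halfplane => _ [v vV <-].
by rewrite pairing_lattice ler_int nV.
Qed.

Lemma lattice_hull_mem (R : realType) (V : seq (int * int)) (v : int * int) :
  v \in V -> convex_hull (lattice_pt R @` [set` V]) (lattice_pt R v).
Proof. by move=> vV B [_]; apply; exists v. Qed.

(** Were [zdot e] non-positive on [V], it would be so on the hull, which contains a small positive
    multiple of [e]. *)
Lemma lattice_hull_surrounds (R : realType) (V : seq (int * int)) :
  (convex_hull (lattice_pt R @` [set` V]))° (0, 0) -> surrounds_origin V.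
Proof.
move=> /nbhs_boxP[r r0 rQ] e e0.
apply: contrapT => noV.
have eV : {in V, forall v, zdot e v <= 0}.
  by move=> v vV; rewrite leNgt; apply/negP => ev; apply: noV; exists v.
have M0 : 0 < `|e.1%:~R| + `|e.2%:~R| + 1 :> R.
  by rewrite ltr_wpDl// addr_ge0.
pose s : R := r / (`|e.1%:~R| + `|e.2%:~R| + 1).
have s0 : 0 < s by rewrite divr_gt0.
have small (a : R) : `|a| < `|e.1%:~R| + `|e.2%:~R| + 1 -> `|0 - s * a| < r.
  move=> aM; rewrite sub0r normrN normrM gtr0_norm// /s mulrAC ltr_pdivrMr//.
  by rewrite ltr_pM2l.
have := lattice_hull_le (R := R) eV (rQ (s * e.1%:~R, s * e.2%:~R) _ _).
rewrite /= => /(_ _ _)/wrap[].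
  by apply: small; have := normr_ge0 (e.2%:~R : R); lra.
  by apply: small; have := normr_ge0 (e.1%:~R : R); lra.
have := zdot_self_gt0 e0; rewrite -(ltr0z R) => e2.
apply/negP; rewrite -ltNge.
have -> : pairing (lattice_pt R e) (s * e.1%:~R, s * e.2%:~R) =
    s * (zdot e e)%:~R.
  by rewrite /pairing /zdot /= intrD !intrM; ring.
by rewrite mulr_gt0.
Qed.

(** Links integral edges to facets: through it the maximal local index bounds [zdot n v] for every
    edge. *)
Lemma edge_local_index (R : realType) (V : seq (int * int))
    (n v w : int * int) :
  let Q := convex_hull (lattice_pt R @` [set` V]) in
  is_edge V n v w -> exists2 F, facet Q F & local_index Q F (zdot n v).
Proof.
move=> Q [vV wV vw np [nvw nmax]].
have nQ := lattice_hull_le (R := R) nmax.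
have faceP x : Q x -> pairing (lattice_pt R n) x = (zdot n v)%:~R ->
    face Q (lattice_pt R n) x.
  by move=> Qx nx; split => // y Qy; rewrite nx nQ.
exists (face Q (lattice_pt R n)); [split|].
- exists (lattice_pt R n) => //.
  apply/eqP => -[/eqP n1 /eqP n2]; move: np; rewrite !intr_eq0 in n1 n2.
  by rewrite (eqP n1) (eqP n2).
- exists (lattice_pt R v), (lattice_pt R w); split.
  + by apply: faceP; [exact: lattice_hull_mem|rewrite pairing_lattice].
  + by apply: faceP; [exact: lattice_hull_mem|rewrite pairing_lattice nvw].
  + apply: contra vw => /eqP[] /eqP + /eqP; rewrite !eqr_int.
    by case: v w {vV wV nvw nmax nQ faceP} => ? ? [? ?] /= /eqP -> /eqP ->.
exists n => // x [Qx xmax]; apply/eqP; rewrite eq_le nQ//=.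
by have := xmax _ (lattice_hull_mem vV); rewrite pairing_lattice.
Qed.

(** * Area of a trapezoid *)

Local Notation area R :=
  (product_measure1 (@lebesgue_measure R) (@lebesgue_measure R)).

(* No measurability is required: that of the polygon is never established. *)
Lemma le_integralT d (T : measurableType d) (R : realType)
    (mu : {measure set T -> \bar R}) (f g : T -> \bar R) :
  (forall x, 0 <= f x)%E -> (forall x, f x <= g x)%E ->
  (\int[mu]_x f x <= \int[mu]_x g x)%E.
Proof.
move=> f0 fg.
have g0 x : (0 <= g x)%E by exact: le_trans (f0 x) (fg x).
rewrite !ge0_integralTE//; apply: le_ereal_sup => _ [h hf <-].
by exists h => // x; exact: le_trans (hf x) (fg x).
Qed.

Lemma le_area (R : realType) (A B : set (R * R)) : A `<=` B ->
  (area R A <=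
   area R B)%E.
Proof.
move=> AB; apply: le_integralT => x /=; first exact: outer_measure_ge0.
apply: le_outer_measure => y; rewrite /xsection /= !inE; exact: AB.
Qed.

Lemma lebesgue_measure_translate (R : realType) (c : R) (S : set R) :
  measurable S -> lebesgue_measure [set y | S (y + c)] = lebesgue_measure S.
Proof.
move=> mS.
have mf : measurable_fun [set: measurableTypeR R]
    (fun y => y + c : measurableTypeR R).
  exact: measurable_funD.
have := @lebesgue_measure_unique R
  (measure_function_pushforward__canonical__measure_function_Measure
    (@lebesgue_measure R) mf).
move=> /(_ _ _ mS)/esym; apply => _ [[a b] _ <-] /=.
rewrite /pushforward.
have -> : (fun y => y + c) @^-1` `]a, b] = `]a - c, b - c]%classic.
  by apply/seteqP; split => y /=; rewrite !in_itv/= ltrBlDr lerBrDr.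
rewrite !lebesgue_measure_itv /= !lte_fin ltrD2r.
by case: ifPn => // _; rewrite -!EFinB; congr (_%:E); ring.
Qed.

(** A shear translates each section at fixed first coordinate. *)
Lemma area_shear (R : realType) (c : R) (S : set (R * R)) :
  measurable (S : set (measurableTypeR R * measurableTypeR R)) ->
  area R
    [set z | S (z.1, z.2 + c * z.1)] =
  area R S.
Proof.
move=> mS; apply: eq_integral => x _ /=.
rewrite -(@lebesgue_measure_translate R (c * x) (xsection S x)); last first.
  exact: measurable_xsection.
by congr lebesgue_measure; apply/seteqP; split => y /=; rewrite /xsection /= !inE.
Qed.

Lemma area_ysection (R : realType) (S : set (R * R)) :
  measurable (S : set (measurableTypeR R * measurableTypeR R)) ->
  area R S =
  (\int[@lebesgue_measure R]_y lebesgue_measure (ysection S y))%E.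
Proof.
move=> mS; transitivity (product_measure2 (@lebesgue_measure R) (@lebesgue_measure R) S) => //.
by apply: product_measure_unique => // A B mA mB; exact: product_measure2E.
Qed.

Lemma integral_affine (R : realType) (a b p q : R) : a < b ->
  (\int[@lebesgue_measure R]_(y in `[a, b]) (p + q * y)%:E =
   ((b - a) * (p + q * ((a + b) / 2)))%:E)%E.
Proof.
move=> ab.
have dF (x : R) : is_derive x 1 (fun y => p * y + q / 2 * (y * y)) (p + q * x).
  apply: is_derive_eq.
  by rewrite /GRing.scale /=; field.
have cF : continuous (fun y : R => p * y + q / 2 * (y * y)).
  move=> x; apply/differentiable_continuous/derivable1_diffP.
  by have [] := dF x.
rewrite (@continuous_FTC2 _ _ (fun y => p * y + q / 2 * (y * y)))//.
- by rewrite -EFinB; congr (_%:E); field.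
- apply: continuous_subspaceT => x; apply: continuousD; first exact: cvg_cst.
  by apply: continuousM; [exact: cvg_cst|exact: cvg_id].
- split; last 2 first.
  + exact/cvg_at_right_filter/cF.
  + exact/cvg_at_left_filter/cF.
  + by move=> x _; have [] := dF x.
- by move=> x _; rewrite derive1E; have [_] := dF x.
Qed.

(** [F] is abstract so that the bound serves for sections in either direction. The affine width is
    non-negative at both ends of [[A, B]], hence in between. *)
Lemma integral_sections_le (R : realType) (F : R -> set R)
    (A B a0 a1 b0 b1 : R) :
  A < B -> a0 + a1 * A <= b0 + b1 * A -> a0 + a1 * B <= b0 + b1 * B ->
  (forall y x, F y x -> A <= y <= B /\ a0 + a1 * y <= x <= b0 + b1 * y) ->
  (\int[@lebesgue_measure R]_y lebesgue_measure (F y) <=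
   ((B - A) * ((b0 - a0) + (b1 - a1) * ((A + B) / 2)))%:E)%E.
Proof.
move=> AB wA wB FS.
rewrite -integral_affine// [leRHS]integral_mkcond.
apply: le_integralT => y; first exact: outer_measure_ge0.
rewrite patchE mem_setE; case: ifPn => yAB; last first.
  have -> : F y = set0; last by rewrite measure0.
  by apply/seteqP; split => x // /FS[yAB' _]; move: yAB; rewrite in_itv /= yAB'.
apply: (@le_trans _ _ (lebesgue_measure `[a0 + a1 * y, b0 + b1 * y]%classic)).
  by apply: le_outer_measure => x /FS[_]; rewrite /= in_itv.
rewrite lebesgue_measure_itv /= lte_fin; case: ltP => _.
  by rewrite -EFinB lee_fin le_eqVlt; apply/orP; left; apply/eqP; ring.
by rewrite lee_fin; move: yAB; rewrite in_itv /= => /andP[Ay yB]; nra.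
Qed.

(** A shear of slope [c] makes the level lines horizontal. The trapezoid [S] so obtained is an
    intersection of half-planes, hence measurable, so shear invariance and the exchange of sections
    apply to it. *)
Lemma trapezoid_area (R : realType) (Q : set (R * R)) (c A B a0 a1 b0 b1 : R) :
  A < B -> a0 + a1 * A <= b0 + b1 * A -> a0 + a1 * B <= b0 + b1 * B ->
  (forall z, Q z -> A <= z.2 + c * z.1 <= B /\
    a0 + a1 * (z.2 + c * z.1) <= z.1 <= b0 + b1 * (z.2 + c * z.1)) ->
  (area R Q <= ((B - A) * ((b0 - a0) + (b1 - a1) * ((A + B) / 2)))%:E)%E.
Proof.
move=> AB wA wB QS.
pose S : set (R * R) := [set z | A <= z.2 <= B /\
  a0 + a1 * z.2 <= z.1 <= b0 + b1 * z.2].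
have mS : measurable (S : set (measurableTypeR R * measurableTypeR R)).
  have mle (p q p' q' : R) :
    measurable [set z : measurableTypeR R * measurableTypeR R |
      p + q * z.2 <= p' * z.1 + q' * z.2 :> R].
    rewrite -[X in measurable X]setTI; apply: measurable_fun_le => //.
      by apply: measurable_funD => //; exact: measurable_funM.
    by apply: measurable_funD => //; exact: measurable_funM.
  have -> : S = [set z | A + 0 * z.2 <= 0 * z.1 + 1 * z.2] `&`
     [set z | (- B) + 0 * z.2 <= 0 * z.1 + (-1) * z.2] `&`
     [set z | a0 + a1 * z.2 <= 1 * z.1 + 0 * z.2] `&`
     [set z | - b0 + (- b1) * z.2 <= (- 1) * z.1 + 0 * z.2].
    apply/seteqP; split => z; rewrite /S /=.
      by move=> [/andP[? ?] /andP[? ?]]; repeat split; lra.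
    by move=> [[[? ?] ?] ?]; split; apply/andP; split; lra.
  by do 3 (apply: measurableI; last exact: mle); exact: mle.
apply: (@le_trans _ _ (area R S)).
  by rewrite -(area_shear c mS); apply: le_area => z /QS.
rewrite area_ysection//; apply: integral_sections_le => // y x.
by rewrite /ysection /= inE.
Qed.

(** Area in the unimodular coordinates given by [t] and [u]. If [u.2] is non-zero,
    [pairing u z / u.2] is a sheared second coordinate and the determinant condition recovers [z.1]
    from the two pairings. *)
Lemma strip_area (R : realType) (Q : set (R * R)) (t u : R * R)
    (l h L0 L1 U0 U1 : R) :
  t.1 * u.2 - t.2 * u.1 = 1 -> - h < l ->
  L0 + L1 * l <= U0 + U1 * l -> L0 + L1 * - h <= U0 + U1 * - h ->
  (forall z, Q z -> - h <= pairing u z <= l /\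
    L0 + L1 * pairing u z <= pairing t z <= U0 + U1 * pairing u z) ->
  (area R Q <= ((l + h) * ((U0 - L0) + (U1 - L1) * ((l - h) / 2)))%:E)%E.
Proof.
case: t u => t1 t2 [u1 u2]; rewrite /pairing /= => tu hl wl wh QS.
have [u2p|u2n|u20] := ltgtP 0 u2.
- have -> : (l + h) * (U0 - L0 + (U1 - L1) * ((l - h) / 2)) =
    (l / u2 - - h / u2) * ((u2 * U0 - u2 * L0) + ((u2 * U1 - t2) * u2 -
      (u2 * L1 - t2) * u2) * ((- h / u2 + l / u2) / 2)).
    by field; rewrite gt_eqF.
  apply: (@trapezoid_area _ _ (u1 / u2)).
  + by rewrite ltr_pM2r ?invr_gt0.
  + have := ler_wpM2l (ltW u2p) wh.
    by rewrite -!mulrA !(mulrC u2 (- h / u2)) !divfK ?gt_eqF//; lra.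
  + have := ler_wpM2l (ltW u2p) wl.
    by rewrite -!mulrA !(mulrC u2 (l / u2)) !divfK ?gt_eqF//; lra.
  + case=> x y /QS /=; have -> : y + u1 / u2 * x = (u1 * x + u2 * y) / u2.
      by field; rewrite gt_eqF.
    have xE : x = u2 * (t1 * x + t2 * y) - t2 * (u1 * x + u2 * y).
      by rewrite -[LHS]mul1r -tu; ring.
    move: (t1 * x + t2 * y) (u1 * x + u2 * y) xE => s Y -> [/andP[Yh Yl]].
    move=> /andP[/(ler_wpM2l (ltW u2p)) sL /(ler_wpM2l (ltW u2p)) sU].
    rewrite !ler_pM2r ?invr_gt0// Yh Yl -!mulrA !(mulrC u2 (Y / u2)).
    by rewrite !divfK ?gt_eqF//; split => //; apply/andP; split; lra.
(* Dividing by a negative [u2] swaps the ends [l] and [- h] and the lower and upper bounds. *)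
- have v2p : 0 < - u2 by rewrite oppr_gt0.
  have u20 : u2 != 0 by rewrite lt_eqF.
  have -> : (l + h) * (U0 - L0 + (U1 - L1) * ((l - h) / 2)) =
    (- h / u2 - l / u2) * ((u2 * L0 - u2 * U0) + ((u2 * L1 - t2) * u2 -
      (u2 * U1 - t2) * u2) * ((l / u2 + - h / u2) / 2)) by field.
  apply: (@trapezoid_area _ _ (u1 / u2)).
  + by rewrite ltr_nM2r ?invr_lt0.
  + have := ler_wpM2l (ltW v2p) wl.
    by rewrite -!mulrA !(mulrC u2 (l / u2)) !divfK//; lra.
  + have := ler_wpM2l (ltW v2p) wh.
    by rewrite -!mulrA !(mulrC u2 (- h / u2)) !divfK//; lra.
  + case=> x y /QS /=; have -> : y + u1 / u2 * x = (u1 * x + u2 * y) / u2.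
      by field.
    have xE : x = u2 * (t1 * x + t2 * y) - t2 * (u1 * x + u2 * y).
      by rewrite -[LHS]mul1r -tu; ring.
    move: (t1 * x + t2 * y) (u1 * x + u2 * y) xE => s Y -> [/andP[Yh Yl]].
    move=> /andP[/(ler_wpM2l (ltW v2p)) sL /(ler_wpM2l (ltW v2p)) sU].
    rewrite !ler_nM2r ?invr_lt0// Yh Yl -!mulrA !(mulrC u2 (Y / u2)).
    by rewrite !divfK//; split => //; apply/andP; split; lra.
(* Now the level lines of [u] are vertical, and sections at fixed first coordinate are used
   directly. *)
subst u2; have {}tu : t2 * u1 = - 1 by move: tu; rewrite mulr0 sub0r => <-; ring.
have [u1p|u1n|u10] := ltgtP 0 u1.
- have u10 : u1 != 0 by rewrite gt_eqF.
  have -> : (l + h) * (U0 - L0 + (U1 - L1) * ((l - h) / 2)) =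
    (l / u1 - - h / u1) * ((- u1 * L0 - - u1 * U0) + ((- u1 * L1 + t1) * u1 -
      (- u1 * U1 + t1) * u1) * ((- h / u1 + l / u1) / 2)) by field.
  apply: integral_sections_le.
  + by rewrite ltr_pM2r ?invr_gt0.
  + have := ler_wpM2l (ltW u1p) wh.
    by rewrite -!mulrA !(mulrC u1 (- h / u1)) !divfK//; lra.
  + have := ler_wpM2l (ltW u1p) wl.
    by rewrite -!mulrA !(mulrC u1 (l / u1)) !divfK//; lra.
  + move=> x y; rewrite /xsection /= inE => /QS /=; rewrite mul0r addr0.
    have yE : y = - u1 * (t1 * x + t2 * y) + t1 * (u1 * x).
      by rewrite -[LHS]opprK -mulN1r -tu; ring.
    have xE : x = (u1 * x) / u1 by field.
    move: (t1 * x + t2 * y) (u1 * x) yE xE => s Y -> -> [/andP[Yh Yl]].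
    move=> /andP[/(ler_wpM2l (ltW u1p)) sL /(ler_wpM2l (ltW u1p)) sU].
    rewrite !ler_pM2r ?invr_gt0// Yh Yl -!mulrA !(mulrC u1 (Y / u1)).
    by rewrite !divfK//; split => //; apply/andP; split; lra.
- have u10 : u1 != 0 by rewrite lt_eqF.
  have v1p : 0 < - u1 by rewrite oppr_gt0.
  have -> : (l + h) * (U0 - L0 + (U1 - L1) * ((l - h) / 2)) =
    (- h / u1 - l / u1) * ((- u1 * U0 - - u1 * L0) + ((- u1 * U1 + t1) * u1 -
      (- u1 * L1 + t1) * u1) * ((l / u1 + - h / u1) / 2)) by field.
  apply: integral_sections_le.
  + by rewrite ltr_nM2r ?invr_lt0.
  + have := ler_wpM2l (ltW v1p) wl.
    by rewrite -!mulrA !(mulrC u1 (l / u1)) !divfK//; lra.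
  + have := ler_wpM2l (ltW v1p) wh.
    by rewrite -!mulrA !(mulrC u1 (- h / u1)) !divfK//; lra.
  + move=> x y; rewrite /xsection /= inE => /QS /=; rewrite mul0r addr0.
    have yE : y = - u1 * (t1 * x + t2 * y) + t1 * (u1 * x).
      by rewrite -[LHS]opprK -mulN1r -tu; ring.
    have xE : x = (u1 * x) / u1 by field.
    move: (t1 * x + t2 * y) (u1 * x) yE xE => s Y -> -> [/andP[Yh Yl]].
    move=> /andP[/(ler_wpM2l (ltW v1p)) sL /(ler_wpM2l (ltW v1p)) sU].
    rewrite !ler_nM2r ?invr_lt0// Yh Yl -!mulrA !(mulrC u1 (Y / u1)).
    by rewrite !divfK//; split => //; apply/andP; split; lra.
by move: tu; rewrite -u10 mulr0 => /eqP; rewrite eq_sym oppr_eq0 oner_eq0.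
Qed.

(** * Counting points and estimating widths *)

(* [Y] is the row of a point and [s] its position in that row; [side] separates
   the at most two points of an inner row. *)
Lemma card_le_rows (B : set (int * int)) (s Y : int * int -> int)
    (side : int * int -> bool) (l h M N : nat) (s0 s1 : int) :
  (forall p p', s p = s p' -> Y p = Y p' -> p = p') ->
  (forall p, B p -> - h%:Z <= Y p <= l%:Z) ->
  (forall p, B p -> Y p = l%:Z -> s0 <= s p < s0 + M%:Z) ->
  (forall p, B p -> Y p = - h%:Z -> s1 <= s p < s1 + N%:Z) ->
  (forall p p', B p -> B p' -> Y p = Y p' -> - h%:Z < Y p < l%:Z ->
    side p = side p' -> p = p') ->
  B #<= `I_(M + N + 2 * (l + h))%N.
Proof.
move=> inj Yb top bot mid.
(* The first [M] codes serve the top row, the next [N] the bottom row, then two each inner row.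
   Inner rows have [1 <= Y p + h <= l + h - 1], so every code is below [M + N + 2 (l + h)]. *)
pose f p := if Y p == l%:Z then `|s p - s0|%N
            else if Y p == - h%:Z then (M + `|(s p - s1)%R|)%N
            else (M + N + 2 * `|(Y p + h%:Z)%R| + side p)%N.
have finj : {in B &, injective f}.
  move=> p p'; rewrite !inE => Bp Bp'; rewrite /f.
  have := Yb _ Bp; have := Yb _ Bp'.
  have [Yp|Yp] := eqVneq (Y p) l%:Z; have [Yp'|Yp'] := eqVneq (Y p') l%:Z.
  - by move: (top _ Bp Yp) (top _ Bp' Yp') => *; apply: inj; lia.
  - have := top _ Bp Yp; have [Zp'|Zp'] := eqVneq (Y p') (- h%:Z); last lia.
    by have := bot _ Bp' Zp'; lia.
  - have := top _ Bp' Yp'; have [Zp|Zp] := eqVneq (Y p) (- h%:Z); last lia.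
    by have := bot _ Bp Zp; lia.
  have [Zp|Zp] := eqVneq (Y p) (- h%:Z);
    have [Zp'|Zp'] := eqVneq (Y p') (- h%:Z).
  - by move: (bot _ Bp Zp) (bot _ Bp' Zp') => *; apply: inj; lia.
  - by have := bot _ Bp Zp; lia.
  - by have := bot _ Bp' Zp'; lia.
  move=> h1 h2 e.
  have [YY ss] : Y p = Y p' /\ side p = side p'.
    by move: e h1 h2; case: (side p) (side p') => -[]; split => //; lia.
  by apply: mid => //; lia.
rewrite -(card_le_eql (inj_card_eq finj)); apply: subset_card_le.
move=> _ [p Bp <-]; rewrite /f /=.
have := Yb _ Bp; have := top _ Bp; have := bot _ Bp.
have [Yp|Yp] := eqVneq (Y p) l%:Z; first by move=> _ /(_ Yp); lia.
have [Zp|Zp] := eqVneq (Y p) (- h%:Z); first by move=> /(_ Zp); lia.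
by case: (side p); lia.
Qed.

(* [w0], [A] and [C] are the widths of the rows at heights [0], [l] and [-h].
   The last hypothesis is needed because [w0 <= 2 * k] alone does not give the
   volume bound when [k = l = 2] and [h = 4]. *)
Lemma width_bounds (R : realType) (k l h : nat) (A C w0 : R) :
  (2 <= k)%N -> (0 < l <= k)%N -> (0 < h <= 2 * l)%N ->
  0 < A -> 0 <= C -> h%:R * A + l%:R * C = (l%:R + h%:R) * w0 ->
  w0 <= 2 * k%:R ->
  (k = 2%N -> l = 2%N -> w0 <= 3 \/ 2 <= A) ->
  (l%:R + h%:R) * (A + C) <= (4 * k ^ 3 + 8 * k ^ 2)%N%:R /\
  A + C + 2 + 2 * (l%:R + h%:R) <= (4 * k ^ 2 + 8 * k)%N%:R.
Proof.
move=> k2 /andP[l0 lk] /andP[h0 hl] A0 C0 E w0k special.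
have k2R : 2 <= k%:R :> R by rewrite ler_nat.
have l0R : 1 <= l%:R :> R by rewrite ler1n.
have h0R : 1 <= h%:R :> R by rewrite ler1n.
have lkR : l%:R <= k%:R :> R by rewrite ler_nat.
have hlR : h%:R <= 2 * l%:R :> R by rewrite -natrM ler_nat.
have -> : (4 * k ^ 3 + 8 * k ^ 2)%N%:R = 4 * k%:R ^+ 3 + 8 * k%:R ^+ 2 :> R.
  by rewrite natrD (natrM _ 4 (k ^ 3)) (natrM _ 8 (k ^ 2)) !natrX.
have -> : (4 * k ^ 2 + 8 * k)%N%:R = 4 * k%:R ^+ 2 + 8 * k%:R :> R.
  by rewrite natrD (natrM _ 4 (k ^ 2)) (natrM _ 8 k) natrX.
have LH0 := mulr_ge0 (_ : 0 <= l%:R + h%:R) (_ : 0 <= 2 * k%:R - w0).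
have {}LH0 : 0 <= (l%:R + h%:R) * (2 * k%:R - w0) by apply: LH0; lra.
(* The smaller of [h] and [l], times [A + C], is at most [h A + l C], hence at most
   [2 k (l + h)]. *)
have [hl'|lh] := leqP h l.
  have hlR' : h%:R <= l%:R :> R by rewrite ler_nat.
  have hp : 0 < h%:R :> R by lra.
  have CLH : 0 <= C * (l%:R - h%:R) by apply: mulr_ge0; lra.
  have hS : h%:R * (A + C) <= 2 * k%:R * (l%:R + h%:R) by lra.
  have K2 : 0 <= k%:R * k%:R * (h%:R - 1) :> R.
    by rewrite !mulr_ge0//; lra.
  have KL : 0 <= (k%:R - l%:R) * k%:R :> R by apply: mulr_ge0; lra.
  have KH : 0 <= (k%:R - h%:R) * h%:R :> R by apply: mulr_ge0; lra.
  have KLH : 0 <= (k%:R - l%:R) * h%:R :> R by apply: mulr_ge0; lra.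
  have KH0 : 0 <= k%:R * h%:R :> R by apply: mulr_ge0; lra.
  have KKH0 : 0 <= k%:R * k%:R * h%:R :> R by rewrite !mulr_ge0//; lra.
  split; rewrite -(ler_pM2l hp).
    have KL' : 0 <= (k%:R - l%:R) * l%:R :> R by apply: mulr_ge0; lra.
    have e4 : (l%:R + h%:R) ^+ 2 <= h%:R * (2 * k%:R ^+ 2 + 4 * k%:R) :> R.
      by lra.
    apply: (@le_trans _ _ ((l%:R + h%:R) * (2 * k%:R * (l%:R + h%:R)))).
      by rewrite mulrCA ler_wpM2l//; lra.
    have K0 : 0 <= 2 * k%:R :> R by lra.
    by have := ler_wpM2l K0 e4; lra.
  have KKH : 0 <= (k%:R - 2) * h%:R :> R by apply: mulr_ge0; lra.
  by lra.
have lhR : l%:R <= h%:R :> R by rewrite ler_nat ltnW.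
have lp : 0 < l%:R :> R by lra.
have AHL : 0 <= A * (h%:R - l%:R) by apply: mulr_ge0; lra.
have lS : l%:R * (A + C) <= 2 * k%:R * (l%:R + h%:R) by lra.
have KLH : 0 <= k%:R * (2 * l%:R - h%:R) :> R by apply: mulr_ge0; lra.
have S6 : A + C <= 6 * k%:R by rewrite -(ler_pM2l lp); lra.
have KK : 0 <= (k%:R - 2) * k%:R :> R by apply: mulr_ge0; lra.
split; last by lra.
(* Here [l + h <= 3 k] and [A + C <= 6 k]; the product [18 k^2] is within the bound for [k >= 3] but
   not for [k = 2]. *)
have [k3|] := ltnP 2 k.
  have k3R : 3 <= k%:R :> R by rewrite ler_nat.
  have h1 : (l%:R + h%:R) * (A + C) <= (3 * k%:R) * (6 * k%:R).
    by apply: ler_pM; lra.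
  have : 0 <= k%:R * k%:R * (k%:R - 3) :> R by rewrite !mulr_ge0//; lra.
  have : 0 <= k%:R * k%:R :> R by rewrite mulr_ge0.
  by lra.
move=> kle; have kE : k = 2%N by apply/eqP; rewrite eqn_leq kle.
move: special w0k S6 lS; rewrite kE => special w0k S6 lS.
have [l2|lne] := eqVneq l 2%N; last first.
  have lE : l = 1%N by clear -kE lk l0 lne; lia.
  have hE : h = 2%N by clear -lE lh hl; lia.
  by move: lS; rewrite lE hE; lra.
(* For [l = 2] and [h = 4] the identity reads [A + C = 3 w0 - A], so either alternative of [special]
   gives [A + C <= 10]. *)
have [h4|hne] := eqVneq h 4%N.
  move: E; rewrite l2 h4; case: (special erefl l2); lra.
have hE : h = 3%N by clear -l2 lh hl hne; lia.
by move: lS; rewrite l2 hE; lra.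
Qed.

(** Phrased as a window of consecutive integers, the form in which [card_le_rows] takes the two
    extreme rows. *)
Lemma int_itv_trunc (R : realType) (L U : R) (s : int) :
  L <= s%:~R <= U ->
  Num.ceil L <= s < Num.ceil L + (Num.trunc (U - L)).+1%:Z.
Proof.
move=> /andP[Ls sU]; rewrite ceil_le_int Ls /= addrC -ltrBlDr.
have cs : 0 <= s - Num.ceil L by rewrite subr_ge0 ceil_le_int.
move: cs; case sE: (s - Num.ceil L) => [n|n] // _.
rewrite ltz_nat ltnS truncn_ge_nat; last by rewrite subr_ge0 (le_trans Ls).
have -> : n%:R = s%:~R - (Num.ceil L)%:~R :> R by rewrite -intrB sE.
by have := ceil_ge L; lra.
Qed.

(** Cramer's rule with determinant 1. *)
Lemma eq_of_pairings (R : realType) (t u : int * int) (x y : R * R) :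
  t.1 * u.2 - t.2 * u.1 = 1 ->
  pairing (lattice_pt R t) x = pairing (lattice_pt R t) y ->
  pairing (lattice_pt R u) x = pairing (lattice_pt R u) y -> x = y.
Proof.
move=> /(congr1 (fun z : int => z%:~R : R)); rewrite intrB !intrM.
rewrite /pairing /=; move: (t.1%:~R) (t.2%:~R) (u.1%:~R) (u.2%:~R) => a b c d.
case: x y => x1 x2 [y1 y2] /= D ta ua; congr pair.
  transitivity ((a * d - b * c) * x1); first by rewrite D mul1r.
  transitivity ((a * d - b * c) * y1); last by rewrite D mul1r.
  transitivity (d * (a * x1 + b * x2) - b * (c * x1 + d * x2)); first by ring.
  by rewrite ta ua; ring.
transitivity ((a * d - b * c) * x2); first by rewrite D mul1r.
transitivity ((a * d - b * c) * y2); last by rewrite D mul1r.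
transitivity (a * (c * x1 + d * x2) - c * (a * x1 + b * x2)); first by ring.
by rewrite ta ua; ring.
Qed.

(** Along a row [s] is an affine coordinate, so [x] divides the segment from [z] to [y] in a ratio
    [r < 1]. The disjunction covers both directions. *)
Lemma row_interior (R : realType) (A : set (R * R)) (t u : int * int)
    (z x y : R * R) :
  let s := pairing (lattice_pt R t) in let Y := pairing (lattice_pt R u) in
  t.1 * u.2 - t.2 * u.1 = 1 ->
  (convex_hull A)° z -> closure (convex_hull A) y ->
  Y x = Y z -> Y y = Y z ->
  (s z <= s x < s y) || (s y < s x <= s z) ->
  (convex_hull A)° x.
Proof.
move=> s Y tu zQ yQ Yx Yy sxy.
have sn : s y - s z != 0.
  rewrite subr_eq0; apply/eqP => e; move: sxy; rewrite e.
  by case/orP => /andP[h1 h2]; [have := le_lt_trans h1 h2|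
    have := lt_le_trans h1 h2]; rewrite ltxx.
pose r := (s x - s z) / (s y - s z).
have [r0 r1] : 0 <= r /\ r < 1.
  rewrite /r; move: sxy sn; move: (s x) (s y) (s z) => sx sy sz.
  case/orP => /andP[s1 s2] _.
    have p : 0 < sy - sz by lra.
    by split; [apply: divr_ge0; lra|rewrite ltr_pdivrMr//; lra].
  have p : sy - sz < 0 by lra.
  split; last by rewrite ltr_ndivrMr//; lra.
  by apply: mulr_le0; rewrite ?invr_le0; lra.
have := convex_hull_interior zQ yQ r0 r1.
congr ((convex_hull A)° _); apply: (eq_of_pairings tu).
  transitivity ((1 - r) * s z + r * s y).
    by rewrite /s /pairing /=; ring.
  by rewrite /r -/(s x); field.
transitivity ((1 - r) * Y z + r * Y y); first by rewrite /Y /pairing /=; ring.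
by rewrite -/(Y x) Yx Yy; ring.
Qed.

(** Every inner row contains an interior point. Of two boundary points on the same side of it, the
    nearer one would be interior, so each side holds at most one. *)
Lemma card_boundary_le (R : realType) (V : seq (int * int)) (t u v w : int * int)
    (l h : nat) (L0 L1 U0 U1 : R) :
  let Q := convex_hull (lattice_pt R @` [set` V]) in
  Q° (0, 0) -> t.1 * u.2 - t.2 * u.1 = 1 ->
  (0 < l)%N -> (0 < h)%N ->
  v \in V -> zdot u v = l%:Z -> w \in V -> zdot u w = - h%:Z ->
  (forall x, closure Q x ->
    - h%:R <= pairing (lattice_pt R u) x <= l%:R /\
    L0 + L1 * pairing (lattice_pt R u) x <= pairing (lattice_pt R t) x <=
    U0 + U1 * pairing (lattice_pt R u) x) ->
  boundary_lattice_pts Q #<=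
    `I_((Num.trunc ((U0 + U1 * l%:R) - (L0 + L1 * l%:R))).+1 +
        (Num.trunc ((U0 + U1 * - h%:R) - (L0 + L1 * - h%:R))).+1 +
        2 * (l + h))%N.
Proof.
move=> Q Q0 tu l0 h0 vV uv wV uw QS.
have l0R : 0 < l%:R :> R by rewrite ltr0n.
have h0R : 0 < h%:R :> R by rewrite ltr0n.
(* The point at height [y] on the broken line from [v] through the origin to [w]. *)
pose c (y : R) : R * R := if 0 <= y
  then (y / l%:R * v.1%:~R, y / l%:R * v.2%:~R)
  else (- y / h%:R * w.1%:~R, - y / h%:R * w.2%:~R).
have cY y : pairing (lattice_pt R u) (c y) = y.
  have uvR : pairing (lattice_pt R u) (lattice_pt R v) = l%:R.
    by rewrite pairing_lattice uv.
  have uwR : pairing (lattice_pt R u) (lattice_pt R w) = - h%:R.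
    by rewrite pairing_lattice uw intrN.
  rewrite /c; case: ifP => _.
    transitivity (y / l%:R * pairing (lattice_pt R u) (lattice_pt R v)).
      by rewrite /pairing /=; ring.
    by rewrite uvR divfK// gt_eqF.
  transitivity (- y / h%:R * pairing (lattice_pt R u) (lattice_pt R w)).
    by rewrite /pairing /=; ring.
  by rewrite uwR mulrN divfK ?opprK// gt_eqF.
have cQ y : - h%:R < y < l%:R -> Q° (c y).
  move=> /andP[hy yl]; rewrite /c; case: leP => y0.
    have := @convex_hull_interior R _ (0, 0) (lattice_pt R v) (y / l%:R) Q0.
    rewrite /= !mulr0 !add0r; apply.
    - by apply: subset_closure; exact: lattice_hull_mem.
    - by rewrite divr_ge0// ltW.
    - by rewrite ltr_pdivrMr// mul1r.
  have := @convex_hull_interior R _ (0, 0) (lattice_pt R w) (- y / h%:R) Q0.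
  rewrite /= !mulr0 !add0r; apply.
  - by apply: subset_closure; exact: lattice_hull_mem.
  - by rewrite divr_ge0 ?ltW// oppr_gt0.
  - by rewrite ltr_pdivrMr// mul1r; lra.
have QZ p : boundary_lattice_pts Q p ->
    - h%:R <= ((zdot u p)%:~R : R) <= l%:R /\
    L0 + L1 * (zdot u p)%:~R <= (zdot t p)%:~R <= U0 + U1 * (zdot u p)%:~R.
  by move=> [/QS]; rewrite !pairing_lattice.
apply: (@card_le_rows _ (zdot t) (zdot u) (fun p =>
  pairing (lattice_pt R t) (c (zdot u p)%:~R) < (zdot t p)%:~R) l h _ _
  (Num.ceil (L0 + L1 * l%:R)) (Num.ceil (L0 + L1 * - h%:R))).
- move=> p p' tp up.
  have : lattice_pt R p = lattice_pt R p'.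
    by apply: (eq_of_pairings tu); rewrite !pairing_lattice ?tp ?up.
  move=> [/eqP + /eqP]; rewrite !eqr_int.
  by case: p p' {tp up} => ? ? [? ?] /= /eqP -> /eqP ->.
- by move=> p /QZ[+ _]; rewrite -[l%:R]/(l%:~R) -[h%:R]/(h%:~R) -intrN !ler_int.
- by move=> p /QZ[_] + up; rewrite up; exact: int_itv_trunc.
- by move=> p /QZ[_] + up; rewrite up intrN; exact: int_itv_trunc.
move=> p p' Bp Bp' up uh.
wlog pp' : p p' Bp Bp' up uh / zdot t p <= zdot t p'.
  move=> H; have [/H|/ltW /H] := leP (zdot t p) (zdot t p'); first exact.
  by move=> + e; move=> -> //; rewrite -?up.
have Q_c : Q° (c (zdot u p)%:~R).
  apply: cQ; move: uh.
  by rewrite -[l%:R]/(l%:~R) -[h%:R]/(h%:~R) -intrN !ltr_int.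
have cu := cY (zdot u p)%:~R.
move: Bp Bp' => [Qp np] [Qp' np'].
have [tt|tt] := eqVneq (zdot t p) (zdot t p').
  move=> _.
  have : lattice_pt R p = lattice_pt R p'.
    by apply: (eq_of_pairings tu); rewrite !pairing_lattice ?tt ?up.
  move=> [/eqP + /eqP]; rewrite !eqr_int.
  by case: p p' {up uh pp' Q_c cu Qp np Qp' np' tt} => ? ? [? ?] /= /eqP -> /eqP ->.
have {}pp' : (zdot t p)%:~R < (zdot t p')%:~R :> R.
  by rewrite ltr_int lt_neqAle tt.
(* If both points lie beyond [c], then [p] is between [c] and [p']; otherwise [p'] is between [p]
   and [c]. *)
rewrite -up; case: ltP => [cp _|_ /esym /negbT cp']; exfalso.
  apply: np; apply: (row_interior tu Q_c Qp'); rewrite ?cu ?pairing_lattice ?up//.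
  by rewrite -up (ltW cp) pp'.
rewrite -leNgt in cp'.
apply: np'; apply: (row_interior tu Q_c Qp); rewrite ?cu ?pairing_lattice ?up//.
by rewrite -up cp' pp' orbT.
Qed.

(** * The theorem *)

Theorem theorem1p1 (R : realType) (Q : set (R * R)) (k : nat)
  (hQ : IP_polygon Q) (hk : (2 <= k)%N) (hm : maximal_local_index Q k%:Z) :
  boundary_lattice_pts Q #<= `I_(4 * k ^ 2 + 8 * k)%N /\
  (normalized_volume Q <= (4 * k ^ 3 + 8 * k ^ 2)%N%:R%:E)%E.
Proof.
case: hQ => [[[_ [/finite_seqP[V ->] QE]] _] Q0].
subst Q; set Q := convex_hull _ in Q0 hm *.
have hV := lattice_hull_surrounds Q0.
have edge_le n v w : is_edge V n v w -> zdot n v <= k%:Z.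
  by move=> /(edge_local_index R); exact: hm.2.
have edge_gt0 n v w : is_edge V n v w -> n != 0 -> 0 < zdot n v.
  move=> [_ _ _ _ [_ nmax]] /hV[z zV z0]; exact: lt_le_trans z0 (nmax _ zV).
have [u [v [v' [uE uge]]]] := balanced_edge hV.
have [vV v'V vv' up [uvv' umax]] := uE.
have u0 : u != 0 by apply: contraTneq up => ->.
have [z0 z0V _] := hV u u0.
have [w wV wmin] := seq_argmax (fun z => - zdot u z) z0V.
have [l lE] : exists l : nat, zdot u v = l%:Z.
  exists `|zdot u v|%N; rewrite gez0_abs// ltW//; exact: edge_gt0 uE u0.
have [h hE] : exists h : nat, zdot u w = - h%:Z.
  have Nu0 : - u != 0 by rewrite oppr_eq0.
  have [z zV zu] := hV _ Nu0.
  exists `|zdot u w|%N; rewrite lez0_abs ?opprK//.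
  by have := wmin _ zV; move: zu; rewrite zdotNl; clear; lia.
have h_le z : z \in V -> - h%:Z <= zdot u z by move=> /wmin; rewrite hE lerN2.
have l_gt0 : (0 < l)%N by have := edge_gt0 _ _ _ uE u0; rewrite lE; lia.
have h_gt0 : (0 < h)%N.
  have Nu0 : - u != 0 by rewrite oppr_eq0.
  have [z zV zu] := hV _ Nu0.
  by have := h_le _ zV; move: zu; rewrite zdotNl; clear; lia.
have l_le : (l <= k)%N by have := edge_le _ _ _ uE; rewrite lE; lia.
have h_le2 : (h <= 2 * l)%N by have := uge _ wV; rewrite lE hE; lia.
(* Bezout coefficients complete the height [u] to unimodular coordinates, with [t] measuring
   position along a row. *)
have [[c1 c2] /= c12] := coprimezP _ _ up.
pose t : int * int := (c2, - c1).
have tu : t.1 * u.2 - t.2 * u.1 = 1 by rewrite /t /= -c12; ring.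
(* [d] runs along the rows, so edges whose normals are positive on [d] and on [- d] bound every row
   on its two sides. *)
pose d : int * int := (u.2, - u.1).
have d0 : d != 0.
  apply: contra u0; rewrite -!pair_eqE /= /d /pair_eq /= oppr_eq0.
  by rewrite andbC.
have Nd0 : - d != 0 by rewrite oppr_eq0.
have [n1 [v1 [w1 [n1E n1d]]]] := edge_normal hV d0.
have [n2 [v2 [w2 [n2E n2d]]]] := edge_normal hV Nd0.
(* [d], [d'] is the basis dual to [t], [u]: a normal [n] equals [zdot n d] times [t] plus
   [zdot n d'] times [u]. *)
pose d' : int * int := (- t.2, t.1).
set q1 := zdot n1 d in n1d; set q2 := zdot n2 (- d) in n2d.
pose p1 := zdot n1 d'; pose p2 := zdot n2 d'.
pose a := zdot n1 v1; pose b := zdot n2 v2.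
have ak : a <= k%:Z by exact: edge_le n1E.
have bk : b <= k%:Z by exact: edge_le n2E.
have n1Q : {in V, forall z, zdot n1 z <= a} by case: n1E => ? ? ? ? [].
have n2Q : {in V, forall z, zdot n2 z <= b} by case: n2E => ? ? ? ? [].
have q1R : 0 < q1%:~R :> R by rewrite ltr0z.
have q2R : 0 < q2%:~R :> R by rewrite ltr0z.
have tuR := congr1 (fun z : int => z%:~R : R) tu; rewrite /= intrB !intrM in tuR.
(* Obtained by solving [q1 s + p1 Y <= a] and [- q2 s + p2 Y <= b] for [s]. *)
pose U0 : R := a%:~R / q1%:~R; pose U1 : R := - p1%:~R / q1%:~R.
pose L0 : R := - b%:~R / q2%:~R; pose L1 : R := p2%:~R / q2%:~R.
have QS x : closure Q x ->
    - h%:R <= pairing (lattice_pt R u) x <= l%:R /\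
    L0 + L1 * pairing (lattice_pt R u) x <= pairing (lattice_pt R t) x <=
    U0 + U1 * pairing (lattice_pt R u) x.
  move=> cx.
  have hull_le n c : {in V, forall z, zdot n z <= c} ->
      pairing (lattice_pt R n) x <= c%:~R.
    by move=> /(lattice_hull_le (R := R)) nc; exact: closure_halfplane nc _ cx.
  have pE n : pairing (lattice_pt R n) x =
      (zdot n d)%:~R * pairing (lattice_pt R t) x +
      (zdot n d')%:~R * pairing (lattice_pt R u) x.
    transitivity ((t.1%:~R * u.2%:~R - t.2%:~R * u.1%:~R) *
      pairing (lattice_pt R n) x); first by rewrite tuR mul1r.
    by rewrite /pairing /zdot /d /d' /= !(intrD, intrM, intrN); ring.
  have ux : pairing (lattice_pt R u) x <= l%:R.
    by apply: (hull_le u l%:Z) => z /umax; rewrite lE.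
  have uNx : - pairing (lattice_pt R u) x <= h%:R.
    have -> : - pairing (lattice_pt R u) x = pairing (lattice_pt R (- u)) x.
      by rewrite /pairing /= !intrN; ring.
    by apply: (hull_le (- u) h%:Z) => z /h_le; rewrite zdotNl lerNl.
  split; first by rewrite ux lerNl uNx.
  have := hull_le _ _ n1Q; have := hull_le _ _ n2Q; rewrite (pE n1) (pE n2).
  have -> : zdot n2 d = - q2 by rewrite /q2 zdotNr opprK.
  rewrite -/q1 -/p1 -/p2 intrN.
  move: (pairing _ x) (pairing (lattice_pt R t) x) => Y s n2x n1x.
  have -> : L0 + L1 * Y = (p2%:~R * Y - b%:~R) / q2%:~R.
    by rewrite /L0 /L1; ring.
  have -> : U0 + U1 * Y = (a%:~R - p1%:~R * Y) / q1%:~R.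
    by rewrite /U0 /U1; ring.
  by rewrite ler_pdivrMr// ler_pdivlMr//; apply/andP; split; lra.
have QV z : z \in V -> L0 + L1 * (zdot u z)%:~R <= (zdot t z)%:~R <=
    U0 + U1 * (zdot u z)%:~R.
  move=> zV; have /subset_closure/QS[_] := lattice_hull_mem (R := R) zV.
  by rewrite !pairing_lattice.
pose A := (U0 + U1 * l%:R) - (L0 + L1 * l%:R).
pose C := (U0 + U1 * - h%:R) - (L0 + L1 * - h%:R).
have C0 : 0 <= C.
  have /andP[] := QV _ wV; rewrite hE intrN /C subr_ge0; exact: le_trans.
(* The row at height [l] contains the distinct points [v] and [v']. *)
have A0 : 0 < A.
  have := QV _ vV; have := QV _ v'V; rewrite -uvv' lE.
  move=> /andP[h1 h2] /andP[h3 h4].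
  rewrite /A subr_gt0 lt_neqAle (le_trans h1 h2) andbT.
  apply: contra vv' => /eqP LU; rewrite -LU in h2 h4.
  have : zdot t v = zdot t v'.
    by apply/eqP; rewrite -(eqr_int R) -(le_anti (introT andP (conj h3 h4)))
      -(le_anti (introT andP (conj h1 h2))).
  move=> tvv'; apply/eqP.
  have : lattice_pt R v = lattice_pt R v'.
    by apply: (eq_of_pairings tu); rewrite !pairing_lattice ?tvv' ?uvv'.
  by move=> [/intr_inj + /intr_inj]; case: (v) (v') => ? ? [? ?] /= -> ->.
pose w0 : R := U0 - L0.
have kR : 0 <= k%:R :> R by [].
have frac_le (x q c : int) : 0 < q -> x <= c * q -> x%:~R / q%:~R <= c%:~R :> R.
  by move=> q0 xq; rewrite ler_pdivrMr ?ltr0z// -intrM ler_int.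
have w0E : w0 = a%:~R / q1%:~R + b%:~R / q2%:~R by rewrite /w0 /U0 /L0; ring.
have ak' : a%:~R / q1%:~R <= k%:R :> R.
  by apply: (frac_le _ _ k%:Z) => //; apply: le_trans ak _; rewrite ler_peMr.
have bk' : b%:~R / q2%:~R <= k%:R :> R.
  by apply: (frac_le _ _ k%:Z) => //; apply: le_trans bk _; rewrite ler_peMr.
have [] := @width_bounds R k l h A C w0 hk.
- by rewrite l_gt0.
- by rewrite h_gt0.
- exact: A0.
- exact: C0.
- by rewrite /A /C /w0; ring.
- by rewrite w0E; lra.
- move=> kE l2; subst k.
  (* If one of the quotients in [w0E] is at most 1, then [w0 <= 3]. Otherwise [a = b = 2] and
     [q1 = q2 = 1], so [A] is a positive even integer. *)
  have [aq|qa] := leP a q1.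
    by left; rewrite w0E; have := frac_le a q1 1 n1d; rewrite mul1r => /(_ aq); lra.
  have [bq|qb] := leP b q2.
    by left; rewrite w0E; have := frac_le b q2 1 n2d; rewrite mul1r => /(_ bq); lra.
  right; have [a2 q11 b2 q21] : [/\ a = 2, q1 = 1, b = 2 & q2 = 1].
    by move: ak bk n1d n2d qa qb; clear; split; lia.
  have AE : A = (4 - (p1 + p2) * 2)%:~R.
    by rewrite /A /U0 /U1 /L0 /L1 a2 q11 b2 q21 l2 intrB intrM intrD !divr1; ring.
  by move: A0; rewrite AE ltr0z (ler_int R 2); clear; lia.
move=> volE cntE; split.
  apply: card_le_trans (card_boundary_le Q0 tu l_gt0 h_gt0 vV lE wV hE QS) _.
  rewrite card_le_II -(ler_nat R); apply: le_trans cntE.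
  have tA : (Num.trunc A)%:R <= A by rewrite truncn_le ltW.
  have tC : (Num.trunc C)%:R <= C by rewrite truncn_le.
  rewrite -/A -/C (natrD _ (_ + _)) (natrD _ _.+1) (natrM _ 2) (natrD _ l) -!natr1.
  lra.
have := @strip_area R Q (lattice_pt R t) (lattice_pt R u) l%:R h%:R L0 L1 U0 U1 tuR.
have hl : - h%:R < l%:R :> R.
  by rewrite (@lt_trans _ _ 0) ?oppr_lt0 ?ltr0n.
move=> /(_ hl); rewrite -(subr_ge0 (L0 + L1 * l%:R)) -/A (ltW A0).
rewrite -(subr_ge0 (L0 + L1 * - h%:R)) -/C C0 => /(_ isT isT) area_le.
rewrite /normalized_volume.
apply: (@le_trans _ _ (2%:E * ((l%:R + h%:R) *
  (U0 - L0 + (U1 - L1) * ((l%:R - h%:R) / 2)))%:E)%E).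
  by apply: lee_wpmul2l; [rewrite lee_fin|apply: area_le => x /subset_closure/QS].
(* Twice the mean width of the trapezoid is [A + C]. *)
rewrite -EFinM lee_fin; apply: le_trans volE; rewrite le_eqVlt; apply/orP; left.
by apply/eqP; rewrite /A /C; field.
Qed.
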